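(* Let $P,Q\in\{C^1([0,1])\}^{2\times2}$ and let $K\in\{C^2(\bar D)\}^{2\times2}$, where $D=\{(x,y)\mid 0<x<1,\ 0<y<x\}$, be the unique solution of $$\begin{cases}K_{xx}(x,y)-K_{yy}(x,y)+K(x,y)P(y)=Q(x)K(x,y), & (x,y)\in\bar D,\\[2pt] K(x,x)=\dfrac12\displaystyle\int_0^x\bigl(Q(s)-P(s)\bigr)\,ds, & x\in[0,1],\\[4pt] K_y(x,0)=0, & x\in[0,1].\end{cases}$$ For each $\lambda\in\mathbb{R}$ and each $(b^1,b^2)^{\rm T}\in\mathbb{R}^2$ with $\|(b^1,b^2)^{\rm T}\|_2=1$, let $\psi(x)=\psi(x;\lambda)$ be the solution on $[0,1]$ of $$-\psi''(x)+P(x)\psi(x)=\lambda\psi(x),\qquad \psi(0)=\begin{pmatrix}b^1\\ b^2\end{pmatrix},\qquad \psi'(0)=\begin{pmatrix}0\\0\end{pmatrix},$$ and define $$\Phi(x)=\psi(x)+\int_0^xK(x,y)\,\psi(y)\,dy,\qquad x\in[0,1].$$ Then $\Phi$ satisfies $$-\Phi''(x)+Q(x)\Phi(x)=\lambda\Phi(x),\qquad \Phi(0)=\begin{pmatrix}b^1\\ b^2\end{pmatrix},\qquad \Phi'(0)=\begin{pmatrix}0\\0\end{pmatrix}.$$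
   Context: All functions are real-valued; $\psi$ and $\Phi$ take values in $\mathbb{R}^2$. $\|\cdot\|_2$ is the Euclidean norm on $\mathbb{R}^2$. Subscripts $x,y$ on $K$ denote partial derivatives, taken entrywise; products are matrix (or matrix-vector) products. For given $P,Q$, the kernel $K$ exists and is unique in $\{C^2(\bar D)\}^{2\times2}$. *)

(* Defs.v *)
From HB Require Import structures.
From mathcomp Require Export all_boot all_order all_algebra.
From mathcomp Require Export all_classical all_reals all_analysis.

Set Implicit Arguments.
Unset Strict Implicit.
Unset Printing Implicit Defensive.

Export Order.TTheory GRing.Theory Num.Theory.
Export numFieldNormedType.Exports.

Local Open Scope classical_set_scope.
Local Open Scope ring_scope.

(* Calculus on the closed interval [0, 1]: the increment stays inside the
   interval, so that derivatives at 0 and 1 are one-sided and no value of the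
   function outside [0, 1] is ever used. *)

Definition quot01 (R : realType) (V : normedModType R) (f : R -> V) (x t : R)
  : V := (t - x)^-1 *: (f t - f x).

Definition derivable01 (R : realType) (V : normedModType R) (f : R -> V) :=
  forall x : R, x \in `[0, 1] -> cvg (quot01 f x @ within `[0, 1] x^').

Definition der01 (R : realType) (V : normedModType R) (f : R -> V) (x : R)
  : V := lim (quot01 f x @ within `[0, 1] x^').

Definition C1_01 (R : realType) (V : normedModType R) (f : R -> V) :=
  derivable01 f /\ {within `[0, 1], continuous (der01 f)}.

Definition mxint (R : realType) (m n : nat) (a b : R) (F : R -> 'M[R]_(m, n))
  : 'M[R]_(m, n) :=
  \matrix_(i, j) (\int[@lebesgue_measure R]_(t in `[a, b]) F t i j).

Definition norm2 (R : realType) (n : nat) (v : 'cV[R]_n) : R :=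
  Num.sqrt (\sum_i v i 0 ^+ 2).

Definition triD (R : realType) : set (R * R) :=
  [set z | 0 < z.1 /\ z.1 < 1 /\ 0 < z.2 /\ z.2 < z.1].

Definition pdx (R : realType) (V : normedModType R) (F : R -> R -> V)
  : R -> R -> V := fun x y => derive1 (F^~ y) x.

Definition pdy (R : realType) (V : normedModType R) (F : R -> R -> V)
  : R -> R -> V := fun x y => derive1 (F x) y.

Definition has_partials (R : realType) (V : normedModType R)
    (F : R -> R -> V) :=
  forall x y : R, triD (x, y) ->
    derivable (F^~ y) x 1 /\ derivable (F x) y 1.

(* The filter within (triD R) (nbhs z) does not exclude z, so at a point z of
   the open set D convergence means continuity at z, the limit being F z. *)
Definition extendable (R : realType) (V : normedModType R)
    (F : R -> R -> V) :=
  forall z : R * R, closure (@triD R) z ->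
    cvg ((fun w : R * R => F w.1 w.2) @ within (@triD R) (nbhs z)).

(* The continuous extension of F from D to its closure. *)
Definition ext (R : realType) (V : normedModType R) (F : R -> R -> V)
    (x y : R) : V :=
  lim ((fun w : R * R => F w.1 w.2) @ within (@triD R) (nbhs (x, y))).

(* F is continuous on the closure of D, and its partial derivatives of order
   one and two exist in D and extend continuously to the closure of D; on the
   boundary, a partial derivative of F means this extension. *)
Definition C2_triD (R : realType) (V : normedModType R) (F : R -> R -> V) :=
  [/\ {within closure (@triD R), continuous (fun w : R * R => F w.1 w.2)},
      has_partials F /\ (has_partials (pdx F) /\ has_partials (pdy F)),
      extendable (pdx F) /\ extendable (pdy F),
      extendable (pdx (pdx F)) /\ extendable (pdy (pdx F)) &
      extendable (pdx (pdy F)) /\ extendable (pdy (pdy F))].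

Definition kernel_solution (R : realType) (P Q : R -> 'M[R]_2)
    (K : R -> R -> 'M[R]_2) :=
  [/\ C2_triD K,
      forall x y : R, closure (@triD R) (x, y) ->
        ext (pdx (pdx K)) x y - ext (pdy (pdy K)) x y + K x y *m P y
        = Q x *m K x y,
      forall x : R, x \in `[0, 1] ->
        K x x = 2^-1 *: mxint 0 x (fun s => Q s - P s) &
      forall x : R, x \in `[0, 1] -> ext (pdy K) x 0 = 0].

(* f solves - f'' + A f = lambda f on [0, 1], f 0 = b, f' 0 = 0. *)
Definition ivp_solution (R : realType) (A : R -> 'M[R]_2) (lambda : R)
    (b : 'cV[R]_2) (f : R -> 'cV[R]_2) :=
  [/\ derivable01 f /\ derivable01 (der01 f),
      forall x : R, x \in `[0, 1] ->
        - der01 (der01 f) x + A x *m f x = lambda *: f x,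
      f 0 = b &
      der01 f 0 = 0].

(* Main.v *)
(* The kernel is only differentiable inside the triangle, and the derivatives at
   0 and 1 are one-sided. Both difficulties disappear by composing all data with
   retractions onto the closed triangle and onto [0, 1]: the composites are
   continuous everywhere, and by the mean value theorem a function that is
   continuous on [0, 1] and has on ]0, 1[ a derivative extending continuously to
   [0, 1] has that extension as its one-sided derivative at the endpoints. So it
   suffices to differentiate [Phi] twice at interior points; the boundary terms
   cancel by an integration by parts and the identity
   [K_x(x,x) + K_y(x,x) = (Q(x) - P(x)) / 2]. *)
From mathcomp Require Import ring lra.
Require Import Defs.

Set Implicit Arguments.
Unset Strict Implicit.
Unset Printing Implicit Defensive.

Local Open Scope classical_set_scope.
Local Open Scope ring_scope.

(** * Derivatives and integrals of continuous functions of one variable *)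

(** Multiplying the difference quotient out leaves an increment estimate free of division, which is
    the form that mean value arguments deliver and in which the two signs of [t - c] can be
    exchanged. *)
Lemma is_derive_eps (R : realType) (f : R -> R) (c l : R) :
  (forall e : R, 0 < e -> exists2 d : R, 0 < d &
    forall t, t != c -> `|t - c| < d ->
      `|f t - f c - (t - c) * l| <= e * `|t - c|) ->
  is_derive c 1 f l.
Proof.
move=> H.
suff fl : h^-1 *: (f (h *: 1 + c) - f c) @[h --> 0^'] --> l.
  by apply: DeriveDef; [apply/cvg_ex; exists l|exact/cvg_lim].
apply/cvgrPdist_le => e e0; have [d d0 Hd] := H e e0.
exists d => //= h; rewrite /ball_ /= sub0r normrN => hd h0.
have := Hd (h *: 1 + c); rewrite addrK /GRing.scale/= mulr1.
rewrite -subr_eq0 addrK => /(_ h0 hd) Hh.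
have nh : 0 < `|h| by rewrite normr_gt0.
rewrite -(ler_pM2r nh); apply: le_trans Hh; rewrite -normrM -normrN.
rewrite le_eqVlt; apply/orP; left; apply/eqP; congr (`|_|).
by field.
Qed.

Lemma continuous_integrable (R : realType) (f : R -> R) (a b : R) :
  continuous f -> (@lebesgue_measure R).-integrable `[a, b] (EFin \o f).
Proof.
move=> cf; apply: continuous_compact_integrable; first exact: segment_compact.
exact: continuous_subspaceT.
Qed.

Lemma Rintegral_is_derive (R : realType) (f : R -> R) (a c : R) :
  continuous f -> a < c ->
  is_derive c 1 (fun x => \int[@lebesgue_measure R]_(y in `[a, x]) f y) (f c).
Proof.
move=> cf ac.
have c1 : c < c + 1 by rewrite ltrDl.
have [d1 d2] := @continuous_FTC1_closed R f a c (c + 1) c1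
  (continuous_integrable _ _ cf) ac (cf c).
apply: DeriveDef; first exact: d1.
by rewrite -derive1E; exact: d2.
Qed.

(** This is the ordinary mean value theorem for the primitive of [f], so the intermediate point lies
    strictly inside the interval. *)
Lemma Rintegral_mean (R : realType) (f : R -> R) (a b : R) :
  continuous f -> a < b ->
  exists2 c, c \in `]a, b[ &
    \int[@lebesgue_measure R]_(y in `[a, b]) f y = (b - a) * f c.
Proof.
move=> cf ab.
set F := fun x => \int[@lebesgue_measure R]_(y in `[a, x]) f y.
have dF x : x \in `]a, b[ -> is_derive x 1 F (f x).
  by rewrite in_itv/= => /andP[ax _]; exact: Rintegral_is_derive.
have cF : {within `[a, b], continuous F}.
  apply: (@parameterized_integral_continuous R a b f) (ltW ab) _.
  exact: continuous_integrable.
have [c cab] := MVT ab dF cF.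
rewrite {2}/F set_itv1 Rintegral_set1 subr0 => Fb.
by exists c => //; rewrite mulrC -Fb.
Qed.

Lemma Rintegral_cat (R : realType) (f : R -> R) (a b c : R) :
  continuous f -> a <= b -> b <= c ->
  \int[@lebesgue_measure R]_(y in `[a, c]) f y =
  \int[@lebesgue_measure R]_(y in `[a, b]) f y +
  \int[@lebesgue_measure R]_(y in `[b, c]) f y.
Proof.
move=> cf ab bc.
have := @Rintegral_itvB R f (BLeft a) (BRight c) b
  (continuous_integrable a c cf).
rewrite !bnd_simp => /(_ ab bc) H.
rewrite -(@Rintegral_itv_obnd_cbnd R b (BRight c) f); last first.
  apply: (integrableS _ _ _ (continuous_integrable b c cf)) => //.
  by apply: subset_itvr; rewrite bnd_simp.
by rewrite -H addrC subrK.
Qed.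

Lemma Rintegral_FTC2 (R : realType) (F f : R -> R) (a b : R) :
  a < b -> continuous F -> continuous f ->
  (forall x, x \in `]a, b[ -> is_derive x 1 F (f x)) ->
  \int[@lebesgue_measure R]_(y in `[a, b]) f y = F b - F a.
Proof.
move=> ab cF cf dF.
rewrite /Rintegral (@continuous_FTC2 R f F a b ab) //.
- exact: continuous_subspaceT.
- split=> [x /dF []//||]; last exact: cvg_at_left_filter (cF b).
  exact: cvg_at_right_filter (cF a).
- by move=> x /dF [dx xE]; rewrite derive1E.
Qed.

(** * Jointly continuous functions, and integrals whose upper limit and integrand both move *)

Lemma continuous_curry_l (R : realType) (G : R -> R -> R) (x : R) :
  continuous (fun z : R * R => G z.1 z.2) -> continuous (G x).
Proof.
move=> cG y.
apply: (@continuous_comp _ _ _ (fun y => (x, y)) (fun z : R * R => G z.1 z.2)).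
  exact: (cvg_pair (cvg_cst x) cvg_id).
exact: cG.
Qed.

Lemma continuous_curry_r (R : realType) (G : R -> R -> R) (y : R) :
  continuous (fun z : R * R => G z.1 z.2) -> continuous (G^~ y).
Proof.
move=> cG x.
apply: (@continuous_comp _ _ _ (fun x => (x, y)) (fun z : R * R => G z.1 z.2)).
  exact: (cvg_pair cvg_id (cvg_cst y)).
exact: cG.
Qed.

Lemma continuous_diag (R : realType) (G : R -> R -> R) :
  continuous (fun z : R * R => G z.1 z.2) -> continuous (fun x => G x x).
Proof.
move=> cG x.
apply: (@continuous_comp _ _ _ (fun x => (x, x)) (fun z : R * R => G z.1 z.2)).
  exact: (cvg_pair cvg_id cvg_id).
exact: cG.
Qed.

Lemma continuous_box (R : realType) (G : R -> R -> R) (x y e : R) :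
  continuous (fun z : R * R => G z.1 z.2) -> 0 < e ->
  exists2 d : R, 0 < d & forall x' y', `|x' - x| < d -> `|y' - y| < d ->
    `|G x' y' - G x y| <= e.
Proof.
move=> cG e0.
have /cvgrPdist_le/(_ e e0)/nbhs_ballP[d /= d0 Hd] := cG (x, y).
exists d => // x' y' hx hy; rewrite distrC.
by apply: (Hd (x', y')); split => /=; rewrite /ball/= distrC.
Qed.

(** A tube argument: each [y] of the compact segment has a box on which the estimate holds, and the
    near-covering form of compactness extracts one width [d] valid for all [y]. *)
Lemma uniform_on_segment (R : realType) (G : R -> R -> R) (c a b e : R) :
  continuous (fun z : R * R => G z.1 z.2) -> 0 < e ->
  exists2 d : R, 0 < d & forall x, `|x - c| < d -> forall y, y \in `[a, b] ->
    `|G x y - G c y| <= e.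
Proof.
move=> cG e0.
have /compact_near_coveringP/(_ R (nbhs c) (fun x y => `|G x y - G c y| <= e))
  := @segment_compact R a b.
case.
  move=> y _.
  (* Half of [e], since [G x' y'] and [G c y'] are both compared with [G c y]. *)
  have e20 : 0 < e / 2 by rewrite divr_gt0.
  have [d d0 Hd] := continuous_box c y cG e20.
  exists (ball y d, ball c d); first by split; exact: nbhsx_ballx.
  move=> [y' x'] [/= by' bx'].
  have h1 : `|G x' y' - G c y| <= e / 2 by apply: Hd; rewrite distrC.
  have h2 : `|G c y' - G c y| <= e / 2.
    by apply: Hd; [rewrite subrr normr0|rewrite distrC].
  rewrite -(subrKA (G c y)) (splitr e) (le_trans (ler_normD _ _))// lerD//.
  by rewrite distrC.
move=> d /= d0 Hd; exists d => // x hx y yab.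
by apply: (Hd x) => //; rewrite /ball_ /= distrC.
Qed.

(* Splitting at s compares [G t y] with [G s y] only for y <= s, which is where a
   function on the triangle can be differentiated in its first argument. *)
Lemma Rintegral_increment (R : realType) (G : R -> R -> R) (s t : R) :
  continuous (fun z : R * R => G z.1 z.2) -> 0 < s -> s < t ->
  exists2 u, u \in `]s, t[ &
  \int[@lebesgue_measure R]_(y in `[0, t]) G t y -
  \int[@lebesgue_measure R]_(y in `[0, s]) G s y =
  \int[@lebesgue_measure R]_(y in `[0, s]) (G t y - G s y) + (t - s) * G t u.
Proof.
move=> cG s0 st.
have cGt := @continuous_curry_l R G t cG.
have cGs := @continuous_curry_l R G s cG.
have [u ust Hu] := Rintegral_mean cGt st.
exists u => //; rewrite (Rintegral_cat cGt (ltW s0) (ltW st)) Hu.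
rewrite RintegralB //; last 2 first.
- exact: continuous_integrable.
- exact: continuous_integrable.
by rewrite addrAC.
Qed.

(** The two dependences on [x] are separated through the integral of [G c] over [[0, x]]: the upper
    limit moves under a fixed integrand, then the integrand moves uniformly on [[0, 1]]. *)
Lemma Rintegral_triangle_continuous (R : realType) (G : R -> R -> R) :
  continuous (fun z : R * R => G z.1 z.2) ->
  {within `[0, 1], continuous
    (fun x => \int[@lebesgue_measure R]_(y in `[0, x]) G x y)}.
Proof.
move=> cG; apply/subspace_continuousP => c c01; apply/cvgrPdist_le => e e0.
have e20 : 0 < e / 2 by rewrite divr_gt0.
have cGc := @continuous_curry_l R G c cG.
have /subspace_continuousP/(_ c c01)/cvgrPdist_le/(_ _ e20) :=
  @parameterized_integral_continuous R 0 1 (G c) ler01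
    (continuous_integrable 0 1 cGc).
rewrite /parameterized_integral !near_withinE.
have [d d0 Hd] := @uniform_on_segment R G c 0 1 (e / 2) cG e20.
have : \forall x \near c, `|x - c| < d.
  by exists d => //= x; rewrite /ball_/= distrC.
apply: filterS2 => x xd Px x01; have {}Px := Px x01.
rewrite -(subrKA (\int[@lebesgue_measure R]_(t in `[0, x]) G c t)) (splitr e).
rewrite (le_trans (ler_normD _ _))// lerD//.
have cGx := @continuous_curry_l R G x cG.
rewrite -RintegralB //; last 2 first.
- exact: continuous_integrable.
- exact: continuous_integrable.
move: x01; rewrite /= in_itv/= => /andP[x0 x1].
(* The point [x = 0] is treated apart because [Rintegral_mean] needs an interval of positive
   length. *)
have [x00|xn0] := eqVneq x 0.
  by rewrite x00 set_itv1 Rintegral_set1 normr0 ltW.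
have xp : 0 < x by rewrite lt_def xn0.
have [||v vx ->] := @Rintegral_mean R (fun t => G c t - G x t) 0 x.
- by move=> z; apply: cvgB; [exact: cGc|exact: cGx].
- by [].
rewrite subr0 normrM ger0_norm// -[leRHS]mul1r ler_pM// distrC Hd//.
move: vx; rewrite !in_itv/= => /andP[v0 vx].
by rewrite ltW//= ltW// (lt_le_trans vx).
Qed.

(** * Differentiation of integrals over the triangle and along its diagonal *)

Section leibniz.
Variables (R : realType) (G H : R -> R -> R).
Hypothesis cG : continuous (fun z : R * R => G z.1 z.2).
Hypothesis cH : continuous (fun z : R * R => H z.1 z.2).
Hypothesis dG : forall x y : R, 0 < y -> y < x -> x < 1 ->
  is_derive x 1 (G^~ y) (H x y).
Let F x := \int[@lebesgue_measure R]_(y in `[0, x]) G x y.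

(** Applied with [c] equal to [s] or to [t], so that it serves increments on both sides of [c].
    Three errors of size at most [e] add up: replacing [H] by its values at [c], moving the upper
    limit from [s] to [c], and replacing [G] by its value at the corner [(c, c)]. *)
Let leibniz_bound (e c s t : R) : 0 < s -> s < t -> t < 1 ->
  (forall x y, s <= x <= t -> s <= y <= t -> `|G x y - G c c| <= e) ->
  (forall x y, s <= x <= t -> 0 <= y <= 1 -> `|H x y - H c y| <= e) ->
  `|\int[@lebesgue_measure R]_(y in `[0, s]) H c y -
    \int[@lebesgue_measure R]_(y in `[0, c]) H c y| <= e ->
  `|F t - F s - (t - s) *
    (G c c + \int[@lebesgue_measure R]_(y in `[0, c]) H c y)|
  <= 3 * e * (t - s).
Proof.
move=> s0 st t1 Ge He Pe.
have [u ust] := Rintegral_increment cG s0 st; rewrite -/(F t) -/(F s) => ->.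
set Pc := (\int[@lebesgue_measure R]_(y in `[0, c]) H c y) in Pe *.
set Ps := (\int[@lebesgue_measure R]_(y in `[0, s]) H c y) in Pe.
set I := (\int[@lebesgue_measure R]_(y in `[0, s]) (G t y - G s y)).
have cGt := @continuous_curry_l R G t cG.
have cGs := @continuous_curry_l R G s cG.
have cHc := @continuous_curry_l R H c cH.
have cGts : continuous (fun y => G t y - G s y).
  by move=> z; apply: cvgB; [exact: cGt|exact: cGs].
have cHts : continuous (fun y => (t - s) * H c y).
  by move=> z; apply: cvgM; [exact: cvg_cst|exact: cHc].
have IE : I - (t - s) * Ps = \int[@lebesgue_measure R]_(y in `[0, s])
    ((G t y - G s y) - (t - s) * H c y).
  rewrite RintegralB//; last 2 first.
  - exact: continuous_integrable.
  - exact: continuous_integrable.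
  by rewrite RintegralZl//; exact: continuous_integrable.
(* The mean value theorem for integrals comes first: it fixes a height [v < s] at which the
   horizontal segment from [s] to [t] stays inside the open triangle, where [H] is the derivative of
   [G]. *)
have [||v] :=
  @Rintegral_mean R (fun y => (G t y - G s y) - (t - s) * H c y) 0 s.
- by move=> z; apply: cvgB; [exact: cGts|exact: cHts].
- exact: s0.
rewrite -IE subr0 in_itv/= => /andP[v0 vs].
have [|x||x] := @MVT R (G^~ v) (H^~ v) s t.
- exact: st.
- rewrite in_itv/= => /andP[sx xt]; apply: dG => //; first exact: lt_trans sx.
  exact: lt_trans t1.
- by apply: continuous_subspaceT; exact: continuous_curry_r.
rewrite in_itv/= => /andP[sx xt] -> Iv.
have -> : I + (t - s) * G t u - (t - s) * (G c c + Pc) =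
  (t - s) * (s * (H x v - H c v) + (Ps - Pc) + (G t u - G c c)).
  by move/(canRL (subrK _)): Iv => ->; ring.
rewrite normrM [leLHS]mulrC (gtr0_norm (_ : 0 < t - s)) ?subr_gt0//.
rewrite ler_pM2r ?subr_gt0//.
rewrite (_ : 3 * e = e + e + e); last by ring.
rewrite (le_trans (ler_normD _ _))// lerD//; last first.
  apply: Ge; first by rewrite lexx ltW.
  by move: ust; rewrite in_itv/= => /andP[? ?]; rewrite !ltW.
rewrite (le_trans (ler_normD _ _))// lerD// normrM gtr0_norm//.
have s1 : s <= 1 by rewrite ltW// (lt_trans st).
rewrite -[leRHS]mul1r ler_pM// ?(ltW s0)// He//; first by rewrite !ltW.
by rewrite !ltW//= (lt_le_trans vs).
Qed.

Lemma Rintegral_triangle_is_derive (c : R) : 0 < c -> c < 1 ->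
  is_derive c 1 F (G c c + \int[@lebesgue_measure R]_(y in `[0, c]) H c y).
Proof.
move=> c0 c1; apply: is_derive_eps => e e0.
have e30 : 0 < e / 3 by rewrite divr_gt0.
have [d1 d10 Hd1] := continuous_box c c cG e30.
have [d2 d20 Hd2] := @uniform_on_segment R H c 0 1 (e / 3) cH e30.
have cHc := @continuous_curry_l R H c cH.
(* Continuity at [c] of the primitive of [H c] controls the moved upper limit when [t < c]. *)
have /(@ex_derive _ _ _ _ _ _ _)/derivable1_diffP/differentiable_continuous :=
  Rintegral_is_derive cHc c0.
move=> /cvgrPdist_le/(_ _ e30)[d3 /= d30 Hd3].
pose d := Num.min (Num.min d1 d2) (Num.min d3 (Num.min c (1 - c))).
have d0 : 0 < d by rewrite !lt_min d10 d20 d30 c0 subr_gt0 c1.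
exists d => // t tc; rewrite !lt_min => /andP[/andP[t1 t2]].
move=> /andP[t3 /andP[t4 t5]].
have tpos : 0 < t by move: t4; rewrite ltr_norml => /andP[]; lra.
have tlt1 : t < 1 by move: t5; rewrite ltr_norml => /andP[]; lra.
have eE : 3 * (e / 3) = e by field.
have [tltc|ctlt|/eqP] := ltgtP t c; last by rewrite (negbTE tc).
(* For [t < c] the increment is reversed, so that it runs from [t] up to [c]. *)
- rewrite (ltr0_norm (_ : t - c < 0)) ?subr_lt0// opprB -normrN.
  rewrite [X in `|X|](_ : _ = F c - F t - (c - t) *
    (G c c + \int[@lebesgue_measure R]_(y in `[0, c]) H c y)); last by ring.
  rewrite -eE; apply: leibniz_bound => //.
  + move=> x y /andP[? ?] /andP[? ?]; apply: Hd1.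
      by move: t1; rewrite !ltr_norml => /andP[? ?]; apply/andP; split; lra.
    by move: t1; rewrite !ltr_norml => /andP[? ?]; apply/andP; split; lra.
  + move=> x y /andP[? ?] y01; apply: Hd2; last by rewrite in_itv.
    by move: t2; rewrite !ltr_norml => /andP[? ?]; apply/andP; split; lra.
  + by rewrite distrC; apply: Hd3; rewrite /ball_/= distrC.
- rewrite (gtr0_norm (_ : 0 < t - c)) ?subr_gt0// -eE.
  apply: leibniz_bound => //.
  + move=> x y /andP[? ?] /andP[? ?]; apply: Hd1.
      by move: t1; rewrite !ltr_norml => /andP[? ?]; apply/andP; split; lra.
    by move: t1; rewrite !ltr_norml => /andP[? ?]; apply/andP; split; lra.
  + move=> x y /andP[? ?] y01; apply: Hd2; last by rewrite in_itv.
    by move: t2; rewrite !ltr_norml => /andP[? ?]; apply/andP; split; lra.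
  + by rewrite subrr normr0 ltW.
Qed.

End leibniz.

(** The partial derivatives are given only strictly below the diagonal, so the chain rule at
    [(c, c)] is replaced by a path from [(s, s)] through [(t, s)] to [(t, t)]. Both open legs lie in
    the triangle, and the mean value theorem applies to each. *)
Lemma diag_is_derive (R : realType) (K A B : R -> R -> R) (c : R) :
  continuous (fun z : R * R => K z.1 z.2) ->
  continuous (fun z : R * R => A z.1 z.2) ->
  continuous (fun z : R * R => B z.1 z.2) ->
  (forall x y : R, 0 < y -> y < x -> x < 1 ->
    is_derive x 1 (K^~ y) (A x y) /\ is_derive y 1 (K x) (B x y)) ->
  0 < c -> c < 1 -> is_derive c 1 (fun x => K x x) (A c c + B c c).
Proof.
move=> cK cA cB dK c0 c1; apply: is_derive_eps => e e0.
have e20 : 0 < e / 2 by rewrite divr_gt0.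
have [d1 d10 Hd1] := continuous_box c c cA e20.
have [d2 d20 Hd2] := continuous_box c c cB e20.
pose d := Num.min (Num.min d1 d2) (Num.min c (1 - c)).
have d0 : 0 < d by rewrite !lt_min d10 d20 c0 subr_gt0 c1.
have step s t : 0 < s -> s < t -> t < 1 -> `|s - c| < d -> `|t - c| < d ->
  `|K t t - K s s - (t - s) * (A c c + B c c)| <= e * (t - s).
  rewrite !lt_min => s0 st t1 /andP[/andP[s2 s3] _] /andP[/andP[t2 t3] _].
  (* The horizontal leg, at height [s]; the vertical leg at abscissa [t] follows. *)
  have [|x||x] := @MVT R (K^~ s) (A^~ s) s t.
  - by [].
  - by rewrite in_itv/= => /andP[sx xt]; apply dK => //; exact: lt_trans t1.
  - by apply: continuous_subspaceT; exact: continuous_curry_r.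
  rewrite in_itv/= => /andP[sx xt] Kx.
  have [|y||y] := @MVT R (K t) (B t) s t.
  - by [].
  - by rewrite in_itv/= => /andP[sy yt]; apply dK => //; exact: lt_trans sy.
  - by apply: continuous_subspaceT; exact: continuous_curry_l.
  rewrite in_itv/= => /andP[sy yt] Ky.
  have -> : K t t - K s s - (t - s) * (A c c + B c c) =
      (t - s) * ((A x s - A c c) + (B t y - B c c)).
    have -> : K t t - K s s = (K t t - K t s) + (K t s - K s s) by ring.
    by rewrite Kx Ky; ring.
  rewrite normrM [leLHS]mulrC (gtr0_norm (_ : 0 < t - s)) ?subr_gt0//.
  rewrite ler_pM2r ?subr_gt0//.
  rewrite (splitr e) (le_trans (ler_normD _ _))// lerD//.
    apply: Hd1 => //.
    move: t2 s2; rewrite !ltr_norml => /andP[? ?] /andP[? ?].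
    by apply/andP; split; lra.
  apply: Hd2 => //.
  move: t3 s3; rewrite !ltr_norml => /andP[? ?] /andP[? ?].
  by apply/andP; split; lra.
exists d => // t tc td.
have cd : `|c - c| < d by rewrite subrr normr0.
have [t4 t5] : `|t - c| < c /\ `|t - c| < 1 - c.
  by move: td; rewrite !lt_min => /andP[_ /andP[]].
have tpos : 0 < t by move: t4; rewrite ltr_norml => /andP[]; lra.
have tlt1 : t < 1 by move: t5; rewrite ltr_norml => /andP[]; lra.
have [tltc|ctlt|/eqP] := ltgtP t c; last by rewrite (negbTE tc).
- rewrite (ltr0_norm (_ : t - c < 0)) ?subr_lt0// opprB -normrN.
  rewrite [X in `|X|](_ : _ = K c c - K t t - (c - t) * (A c c + B c c));
    last by ring.
  exact: step.
- by rewrite (gtr0_norm (_ : 0 < t - c)) ?subr_gt0//; exact: step.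
Qed.

(** * Entrywise calculus of matrix-valued functions *)

(** Entrywise, to match [mxint] and to reduce every rule to its scalar counterpart. The source is
    any topological space, so that the plane, the line and the subspace [[0, 1]] are all covered. *)
Definition mx_continuous (R : realType) (T : topologicalType) (m n : nat)
    (F : T -> 'M[R]_(m, n)) :=
  forall i j, continuous (fun t => F t i j).

Definition mx_is_derive (R : realType) (m n : nat) (F : R -> 'M[R]_(m, n))
    (x : R) (D : 'M[R]_(m, n)) :=
  forall i j, is_derive x 1 (fun t => F t i j) (D i j).

Section mx_calculus.
Variable R : realType.

Lemma mx_continuousD (T : topologicalType) m n (F G : T -> 'M[R]_(m, n)) :
  mx_continuous F -> mx_continuous G -> mx_continuous (fun t => F t + G t).
Proof.
move=> cF cG i j t; under eq_fun do rewrite mxE.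
by apply: cvgD; [exact: cF|exact: cG].
Qed.

Lemma mx_continuousB (T : topologicalType) m n (F G : T -> 'M[R]_(m, n)) :
  mx_continuous F -> mx_continuous G -> mx_continuous (fun t => F t - G t).
Proof.
move=> cF cG i j t; under eq_fun do rewrite !mxE.
by apply: cvgB; [exact: cF|exact: cG].
Qed.

Lemma mx_continuousM (T : topologicalType) m n p (F : T -> 'M[R]_(m, n))
    (G : T -> 'M[R]_(n, p)) :
  mx_continuous F -> mx_continuous G -> mx_continuous (fun t => F t *m G t).
Proof.
move=> cF cG i j t; under eq_fun do rewrite mxE.
apply: continuous_big => [|k _ u]; first exact: add_continuous.
by apply: cvgM; [exact: cF|exact: cG].
Qed.

Lemma mx_continuousZ (T : topologicalType) m n (a : R) (F : T -> 'M[R]_(m, n)) :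
  mx_continuous F -> mx_continuous (fun t => a *: F t).
Proof.
move=> cF i j t; under eq_fun do rewrite mxE.
by apply: cvgM; [exact: cvg_cst|exact: cF].
Qed.

Lemma mx_continuous_cst (T : topologicalType) m n (A : 'M[R]_(m, n)) :
  mx_continuous (fun _ : T => A).
Proof. by move=> i j t; exact: cvg_cst. Qed.

Lemma mx_continuous_comp (T U : topologicalType) m n (f : T -> U)
    (F : U -> 'M[R]_(m, n)) :
  continuous f -> mx_continuous F -> mx_continuous (F \o f).
Proof.
move=> cf cF i j t.
by apply: (@continuous_comp _ _ _ f (fun u => F u i j)); [exact: cf|exact: cF].
Qed.

Lemma mx_is_deriveD m n (F G : R -> 'M[R]_(m, n)) x A B :
  mx_is_derive F x A -> mx_is_derive G x B ->
  mx_is_derive (fun t => F t + G t) x (A + B).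
Proof.
move=> dF dG i j; under eq_fun do rewrite mxE.
rewrite mxE; have := dF i j; have := dG i j => ? ?.
exact: is_deriveD.
Qed.

Lemma mx_is_deriveB m n (F G : R -> 'M[R]_(m, n)) x A B :
  mx_is_derive F x A -> mx_is_derive G x B ->
  mx_is_derive (fun t => F t - G t) x (A - B).
Proof.
move=> dF dG i j; under eq_fun do rewrite !mxE.
rewrite !mxE; have := dF i j; have := dG i j => ? ?.
exact: is_deriveB.
Qed.

Lemma mx_is_deriveZ m n (a : R) (F : R -> 'M[R]_(m, n)) x A :
  mx_is_derive F x A -> mx_is_derive (fun t => a *: F t) x (a *: A).
Proof.
move=> dF i j; under eq_fun do rewrite mxE.
rewrite mxE; have := dF i j => ?.
exact: is_deriveZ.
Qed.

Lemma mx_is_deriveM m n p (F : R -> 'M[R]_(m, n)) (G : R -> 'M[R]_(n, p))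
    x A B :
  mx_is_derive F x A -> mx_is_derive G x B ->
  mx_is_derive (fun t => F t *m G t) x (A *m G x + F x *m B).
Proof.
move=> dF dG i j; under eq_fun do rewrite mxE.
rewrite !mxE -big_split/=.
have -> : (fun t => \sum_k F t i k * G t k j) =
    \sum_k (fun t => F t i k * G t k j).
  by apply/funext => t; rewrite fct_sumE.
apply: is_derive_sum => k.
have := dF i k; have := dG k j => dGk dFk.
apply: is_derive_eq.
by rewrite /GRing.scale/= addrC; congr (_ + _); rewrite mulrC.
Qed.

Lemma mx_is_derive_unique m n (F : R -> 'M[R]_(m, n)) x A B :
  mx_is_derive F x A -> mx_is_derive F x B -> A = B.
Proof.
move=> dA dB; apply/matrixP => i j.
by case: (dA i j) => _ <-; case: (dB i j).
Qed.

Lemma near_eq_mx_is_derive m n (F G : R -> 'M[R]_(m, n)) x A :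
  (\near x, F x = G x) -> mx_is_derive F x A -> mx_is_derive G x A.
Proof.
move=> FG dF i j; apply: near_eq_is_derive (dF i j).
by apply: filterS FG => t ->.
Qed.

Lemma mx_integrable m n (F : R -> 'M[R]_(m, n)) a b i j : mx_continuous F ->
  (@lebesgue_measure R).-integrable `[a, b] (EFin \o (fun t => F t i j)).
Proof. by move=> cF; exact: continuous_integrable. Qed.

Lemma mxintD m n (F G : R -> 'M[R]_(m, n)) a b :
  mx_continuous F -> mx_continuous G ->
  mxint a b (fun t => F t + G t) = mxint a b F + mxint a b G.
Proof.
move=> cF cG; apply/matrixP => i j; rewrite !mxE.
rewrite -RintegralD//; last 2 first.
- exact: mx_integrable.
- exact: mx_integrable.
by apply: eq_Rintegral => t _; rewrite mxE.
Qed.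

Lemma mxint_mulmxl m n p (A : 'M[R]_(m, n)) (F : R -> 'M[R]_(n, p)) a b :
  mx_continuous F -> mxint a b (fun t => A *m F t) = A *m mxint a b F.
Proof.
move=> cF; apply/matrixP => i j; rewrite !mxE.
under [LHS]eq_Rintegral do rewrite mxE.
rewrite /Rintegral.
under eq_integral do rewrite -sumEFin.
rewrite integral_sum//=; last first.
  move=> k; rewrite (_ : (fun x => _) = EFin \o (fun t => A i k * F t k j))//.
  apply: continuous_integrable => t.
  by apply: cvgM; [exact: cvg_cst|exact: cF].
rewrite (eq_bigr (fun k => (A i k * mxint a b F k j)%:E)) => [|k _].
  by rewrite sumEFin/=; apply: eq_bigr => k _; rewrite mxE.
rewrite mxE -RintegralZl//; last exact: mx_integrable.
rewrite /Rintegral fineK// integrable_fin_num//.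
apply: (@continuous_integrable R (fun t => A i k * F t k j)) => t.
by apply: cvgM; [exact: cvg_cst|exact: cF].
Qed.

Lemma eq_mxint m n (F G : R -> 'M[R]_(m, n)) a b :
  (forall t, t \in `[a, b] -> F t = G t) -> mxint a b F = mxint a b G.
Proof.
move=> FG; apply/matrixP => i j; rewrite !mxE.
by apply: eq_Rintegral => t; rewrite inE/= => tab; rewrite FG.
Qed.

Lemma mxint_point m n (F : R -> 'M[R]_(m, n)) a : mxint a a F = 0.
Proof. by apply/matrixP => i j; rewrite !mxE set_itv1 Rintegral_set1. Qed.

Lemma mxint_FTC2 m n (F f : R -> 'M[R]_(m, n)) a b :
  a < b -> mx_continuous F -> mx_continuous f ->
  (forall x, x \in `]a, b[ -> mx_is_derive F x (f x)) ->
  mxint a b f = F b - F a.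
Proof.
move=> ab cF cf dF; apply/matrixP => i j; rewrite !mxE.
by apply: (@Rintegral_FTC2 R (fun t => F t i j) (fun t => f t i j)) => // x /dF.
Qed.

Lemma mxint_is_derive m n (F : R -> 'M[R]_(m, n)) a c :
  mx_continuous F -> a < c -> mx_is_derive (fun x => mxint a x F) c (F c).
Proof.
move=> cF ac i j; under eq_fun do rewrite mxE.
exact: (@Rintegral_is_derive R (fun t => F t i j)).
Qed.

Lemma mxint_triangle_is_derive m n (G H : R -> R -> 'M[R]_(m, n)) (c : R) :
  mx_continuous (fun z : R * R => G z.1 z.2) ->
  mx_continuous (fun z : R * R => H z.1 z.2) ->
  (forall x y : R, 0 < y -> y < x -> x < 1 -> mx_is_derive (G^~ y) x (H x y)) ->
  0 < c -> c < 1 ->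
  mx_is_derive (fun x => mxint 0 x (G x)) c (G c c + mxint 0 c (H c)).
Proof.
move=> cG cH dG c0 c1 i j; under eq_fun do rewrite mxE.
rewrite !mxE.
apply: (@Rintegral_triangle_is_derive R (fun x y => G x y i j)
  (fun x y => H x y i j)) => //.
by move=> x y y0 yx x1; exact: dG.
Qed.

Lemma mxint_triangle_continuous m n (G : R -> R -> 'M[R]_(m, n)) i j :
  mx_continuous (fun z : R * R => G z.1 z.2) ->
  {within `[0, 1], continuous (fun x => mxint 0 x (G x) i j)}.
Proof.
move=> cG.
have -> : (fun x => mxint 0 x (G x) i j) =
    (fun x => \int[@lebesgue_measure R]_(y in `[0, x]) G x y i j).
  by apply/funext => x; rewrite mxE.
exact: (@Rintegral_triangle_continuous R (fun x y => G x y i j)).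
Qed.

Lemma mx_continuous_snd m n (f : R -> 'M[R]_(m, n)) :
  mx_continuous f -> mx_continuous (fun z : R * R => f z.2).
Proof.
by move=> cf; apply: (mx_continuous_comp (f := snd)) => // z; exact: cvg_snd.
Qed.

End mx_calculus.

(** * The transformed function and its two derivatives at interior points *)

Section transmutation.
Variables (R : realType) (n : nat).
Variables (P Q : R -> 'M[R]_n) (K Kx Ky Kxx Kyy : R -> R -> 'M[R]_n).
Variables (psi psi1 : R -> 'cV[R]_n) (lambda : R).
Hypothesis cP : mx_continuous P.
Hypothesis cQ : mx_continuous Q.
Hypothesis cK : mx_continuous (fun z : R * R => K z.1 z.2).
Hypothesis cKx : mx_continuous (fun z : R * R => Kx z.1 z.2).
Hypothesis cKy : mx_continuous (fun z : R * R => Ky z.1 z.2).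
Hypothesis cKxx : mx_continuous (fun z : R * R => Kxx z.1 z.2).
Hypothesis cKyy : mx_continuous (fun z : R * R => Kyy z.1 z.2).
Hypothesis cpsi : mx_continuous psi.
Hypothesis cpsi1 : mx_continuous psi1.
Hypothesis dK : forall x y : R, 0 < y -> y < x -> x < 1 ->
  mx_is_derive (K^~ y) x (Kx x y) /\ mx_is_derive (K x) y (Ky x y).
Hypothesis dKx : forall x y : R, 0 < y -> y < x -> x < 1 ->
  mx_is_derive (Kx^~ y) x (Kxx x y).
Hypothesis dKy : forall x y : R, 0 < y -> y < x -> x < 1 ->
  mx_is_derive (Ky x) y (Kyy x y).
Hypothesis pde : forall x y : R, 0 <= y -> y <= x -> x <= 1 ->
  Kxx x y - Kyy x y + K x y *m P y = Q x *m K x y.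
Hypothesis Kdiag : forall x : R, 0 <= x -> x <= 1 ->
  K x x = 2^-1 *: mxint 0 x (fun s => Q s - P s).
Hypothesis Ky0 : forall x : R, 0 <= x -> x <= 1 -> Ky x 0 = 0.
Hypothesis dpsi : forall x : R, 0 < x -> x < 1 -> mx_is_derive psi x (psi1 x).
Hypothesis dpsi1 : forall x : R, 0 < x -> x < 1 ->
  mx_is_derive psi1 x (P x *m psi x - lambda *: psi x).
Hypothesis psi1_0 : psi1 0 = 0.

Definition transmuted (x : R) : 'cV[R]_n :=
  psi x + mxint 0 x (fun y => K x y *m psi y).

(** The derivative given by the Leibniz rule; the term at [K x x] comes from the moving upper
    limit. *)
Definition transmuted1 (x : R) : 'cV[R]_n :=
  psi1 x + (K x x *m psi x + mxint 0 x (fun y => Kx x y *m psi y)).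

Let cKpsi : mx_continuous (fun z : R * R => K z.1 z.2 *m psi z.2).
Proof. by apply: mx_continuousM => //; exact: mx_continuous_snd. Qed.

Let cKxpsi : mx_continuous (fun z : R * R => Kx z.1 z.2 *m psi z.2).
Proof. by apply: mx_continuousM => //; exact: mx_continuous_snd. Qed.

Let mx_is_derive_mulr m p q (F : R -> 'M[R]_(m, p)) (B : 'M[R]_(p, q)) x A :
  mx_is_derive F x A -> mx_is_derive (fun t => F t *m B) x (A *m B).
Proof.
move=> dF; rewrite -[A *m B]addr0 -(mulmx0 _ (F x)).
apply: (mx_is_deriveM (G := fun=> B)) dF _ => i j.
by rewrite mxE; exact: is_derive_cst.
Qed.

Let mx_continuous_row (F : R -> R -> 'M[R]_n) x :
  mx_continuous (fun z : R * R => F z.1 z.2) -> mx_continuous (F x).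
Proof.
by move=> cF i j; apply: (@continuous_curry_l R (fun x y => F x y i j)).
Qed.

Let mx_continuous_diag (F : R -> R -> 'M[R]_n) :
  mx_continuous (fun z : R * R => F z.1 z.2) -> mx_continuous (fun x => F x x).
Proof.
by move=> cF i j; apply: (@continuous_diag R (fun x y => F x y i j)).
Qed.

Lemma transmuted_is_derive x : 0 < x -> x < 1 ->
  mx_is_derive transmuted x (transmuted1 x).
Proof.
move=> x0 x1; apply: mx_is_deriveD; first exact: dpsi.
apply: (mxint_triangle_is_derive (G := fun x y => K x y *m psi y)
  (H := fun x y => Kx x y *m psi y)) => // u y y0 yu u1.
by apply: mx_is_derive_mulr; case: (dK y0 yu u1).
Qed.

Lemma kernel_diag_is_derive x : 0 < x -> x < 1 ->
  mx_is_derive (fun t => K t t) x (Kx x x + Ky x x).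
Proof.
move=> x0 x1 i j; rewrite mxE.
apply: (@diag_is_derive R (fun x y => K x y i j) (fun x y => Kx x y i j)
  (fun x y => Ky x y i j)) => // u y y0 yu u1.
by have [] := dK y0 yu u1; split.
Qed.

(** The derivative of [K t t] is computed twice, along the diagonal and from the integral formula.
    That formula holds on [[0, 1]], hence near each interior point. *)
Lemma kernel_diag_derive x : 0 < x -> x < 1 ->
  Kx x x + Ky x x = 2^-1 *: (Q x - P x).
Proof.
move=> x0 x1; apply: mx_is_derive_unique (kernel_diag_is_derive x0 x1) _.
apply: (@near_eq_mx_is_derive _ _ _
  (fun x => 2^-1 *: mxint 0 x (fun s => Q s - P s))).
  near=> t; rewrite Kdiag//.
    by apply: ltW; near: t; exact: lt_nbhsr.
  by apply: ltW; near: t; exact: lt_nbhsl.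
apply: mx_is_deriveZ; apply: (mxint_is_derive (F := fun s => Q s - P s)) => //.
exact: mx_continuousB.
Unshelve. all: by end_near. Qed.

(** The integrand is the [y]-derivative of [Ky x y *m psi y - K x y *m psi1 y], because the mixed
    terms [Ky x y *m psi1 y] cancel. The contribution at [y = 0] vanishes by [Ky0] and [psi1_0]. *)
Lemma kernel_by_parts x : 0 < x -> x < 1 ->
  mxint 0 x (fun y => Kyy x y *m psi y -
                      K x y *m (P y *m psi y - lambda *: psi y)) =
  Ky x x *m psi x - K x x *m psi1 x.
Proof.
move=> x0 x1.
have cKr := mx_continuous_row (x := x) cK.
have cKyr := mx_continuous_row (x := x) cKy.
have cKyyr := mx_continuous_row (x := x) cKyy.
rewrite (mxint_FTC2 (F := fun y => Ky x y *m psi y - K x y *m psi1 y)) //.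
- by rewrite Ky0 ?ltW// psi1_0 mul0mx mulmx0 subrr subr0.
- by apply: mx_continuousB; exact: mx_continuousM.
- apply: mx_continuousB; first exact: mx_continuousM.
  apply: mx_continuousM => //; apply: mx_continuousB.
    exact: mx_continuousM.
  exact: mx_continuousZ.
move=> y; rewrite in_itv/= => /andP[y0 yx].
have y1 := lt_trans yx x1.
have [_ dKyx] := dK y0 yx x1.
have := mx_is_deriveB (mx_is_deriveM (dKy y0 yx x1) (dpsi y0 y1))
  (mx_is_deriveM dKyx (dpsi1 y0 y1)).
by rewrite opprD addrA addrK.
Qed.

(** The kernel equation trades the integral of [Kxx] for the one of [Kyy], which is integrated by
    parts. Then the terms [K x x *m psi1 x] cancel, and the remaining boundary terms are twice
    [(Kx x x + Ky x x) *m psi x], that is [(Q x - P x) *m psi x], which turns [P] into [Q]. *)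
Lemma transmuted1_is_derive x : 0 < x -> x < 1 ->
  mx_is_derive transmuted1 x (Q x *m transmuted x - lambda *: transmuted x).
Proof.
move=> x0 x1.
have cKr := mx_continuous_row (x := x) cK.
have cKyyr := mx_continuous_row (x := x) cKyy.
have dI : mx_is_derive (fun t => mxint 0 t (fun y => Kx t y *m psi y)) x
    (Kx x x *m psi x + mxint 0 x (fun y => Kxx x y *m psi y)).
  apply: (mxint_triangle_is_derive (G := fun x y => Kx x y *m psi y)
    (H := fun x y => Kxx x y *m psi y)) => //.
    by apply: mx_continuousM => //; exact: mx_continuous_snd.
  by move=> u y y0 yu u1; apply: mx_is_derive_mulr; exact: dKx.
(* The term [lambda *: (K x y *m psi y)] is added and subtracted, so that one part of the integrand
   matches [kernel_by_parts] and the other is a constant matrix times [K x y *m psi y]. *)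
have E : mxint 0 x (fun y => Kxx x y *m psi y) =
    Ky x x *m psi x - K x x *m psi1 x +
    (Q x - lambda%:M) *m mxint 0 x (fun y => K x y *m psi y).
  rewrite -kernel_by_parts// -mxint_mulmxl; last exact: mx_continuousM.
  rewrite -mxintD; last 2 first.
  - apply: mx_continuousB; first exact: mx_continuousM.
    apply: mx_continuousM => //; apply: mx_continuousB.
      exact: mx_continuousM.
    exact: mx_continuousZ.
  - by apply: mx_continuousM; [exact: mx_continuous_cst|exact: mx_continuousM].
  apply: eq_mxint => y; rewrite in_itv/= => /andP[y0 yx].
  have /(canRL (addrK _))/(canRL (subrK _)) -> := pde y0 yx (ltW x1).
  rewrite !mulmxBl mul_scalar_mx mulmxDl mulmxBl mulmxBr -scalemxAr !mulmxA.
  apply/matrixP => i k.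
  move: (Kyy x y *m psi y) (K x y *m P y *m psi y) (K x y *m psi y)
    (Q x *m K x y *m psi y).
  by move=> A1 A2 A3 A4; rewrite !mxE; ring.
have := mx_is_deriveD (dpsi1 x0 x1) (mx_is_deriveD
  (mx_is_deriveM (kernel_diag_is_derive x0 x1) (dpsi x0 x1)) dI).
rewrite E; set D := (X in mx_is_derive _ _ X).
suff -> : D = Q x *m transmuted x - lambda *: transmuted x by [].
have /(congr1 (fun A => A *m psi x)) := kernel_diag_derive x0 x1.
rewrite /D /transmuted mulmxDr !mulmxDl !mulNmx -scalemxAl mulmxBl.
rewrite mul_scalar_mx.
move: (mxint 0 x _) => J.
move: (Kx x x *m psi x) (Ky x x *m psi x) (K x x *m psi1 x) (Q x *m psi x)
  (P x *m psi x) (Q x *m J).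
move=> A1 A2 A3 A4 A5 A6 H.
apply/matrixP => i k; have := congr1 (fun A : 'cV[R]_n => A i k) H.
by rewrite !mxE; lra.
Qed.

Lemma transmuted_continuous i j :
  {within `[0, 1], continuous (fun x => transmuted x i j)}.
Proof.
have -> : (fun x => transmuted x i j) =
    (fun x => psi x i j) + (fun x => mxint 0 x (fun y => K x y *m psi y) i j).
  by apply/funext => x; rewrite mxE.
apply: within_continuousD; first by apply: continuous_subspaceT; exact: cpsi.
exact: (mxint_triangle_continuous (G := fun x y => K x y *m psi y)).
Qed.

Lemma transmuted1_continuous i j :
  {within `[0, 1], continuous (fun x => transmuted1 x i j)}.
Proof.
have -> : (fun x => transmuted1 x i j) =
    (fun x => (psi1 x + K x x *m psi x) i j) +
    (fun x => mxint 0 x (fun y => Kx x y *m psi y) i j).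
  by apply/funext => x; rewrite /transmuted1 addrA mxE.
apply: within_continuousD.
  apply: continuous_subspaceT; apply: mx_continuousD => //.
  by apply: mx_continuousM => //; exact: mx_continuous_diag.
exact: (mxint_triangle_continuous (G := fun x y => Kx x y *m psi y)).
Qed.

Lemma transmuted2_continuous i j :
  {within `[0, 1], continuous
    (fun x => (Q x *m transmuted x - lambda *: transmuted x) i j)}.
Proof.
(* With [[0, 1]] as source space, relative continuity becomes plain entrywise continuity, and the
   rules for products and differences apply. *)
have cQs : mx_continuous (Q : subspace (`[0, 1]%classic : set R) -> _).
  by move=> k l; apply: continuous_subspaceT; exact: cQ.
have ct : mx_continuous (transmuted : subspace (`[0, 1]%classic : set R) -> _).
  by move=> k l; exact: transmuted_continuous.
suff : mx_continuous ((fun x => Q x *m transmuted x - lambda *: transmuted x)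
    : subspace (`[0, 1]%classic : set R) -> _) by move=> H; exact: H.
by apply: mx_continuousB; [exact: mx_continuousM|exact: mx_continuousZ].
Qed.

End transmutation.

(** * Retractions onto intervals and onto the closed triangle *)

Section retraction.
Variable R : realType.
Implicit Types x y : R.

Definition clamp (b x : R) : R := Num.max 0 (Num.min x b).

(** The second coordinate is clamped against the already clamped first one, which puts the image in
    the closed triangle. *)
Definition tri_retract (z : R * R) : R * R :=
  (clamp 1 z.1, clamp (clamp 1 z.1) z.2).

Lemma clamp_itv b x : 0 <= b -> 0 <= clamp b x <= b.
Proof.
by move=> b0; rewrite /clamp le_max lexx/= ge_max b0 ge_min lexx orbT.
Qed.

Lemma clamp_id b x : 0 <= x <= b -> clamp b x = x.
Proof. by move=> /andP[x0 xb]; rewrite /clamp min_l// max_r. Qed.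

Lemma continuous_clamp (T : topologicalType) (b f : T -> R) :
  continuous b -> continuous f -> continuous (fun t => clamp (b t) (f t)).
Proof.
move=> cb cf t; apply: (@continuous_max R T (cst 0) (f \min b)).
  exact: cvg_cst.
by apply: continuous_min; [exact: cf|exact: cb].
Qed.

Lemma continuous_clamp1 : continuous (clamp 1).
Proof.
by apply: (@continuous_clamp R (cst 1) id) => x; [exact: cvg_cst|exact: cvg_id].
Qed.

Lemma continuous_tri_retract : continuous tri_retract.
Proof.
have c1 : continuous (fun z : R * R => clamp 1 z.1).
  by apply: continuous_clamp => z; [exact: cvg_cst|exact: cvg_fst].
have c2 : continuous (fun z : R * R => clamp (clamp 1 z.1) z.2).
  by apply: continuous_clamp => // z; exact: cvg_snd.
by move=> z; exact: (cvg_pair (c1 z) (c2 z)).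
Qed.

Lemma tri_retract_id x y : 0 <= y -> y <= x -> x <= 1 ->
  tri_retract (x, y) = (x, y).
Proof.
move=> y0 yx x1; rewrite /tri_retract/= (@clamp_id 1 x); last first.
  by rewrite x1 (le_trans y0).
by rewrite clamp_id// y0.
Qed.

Lemma closure_triD x y : 0 <= y -> y <= x -> x <= 1 ->
  closure (@triD R) (x, y).
Proof.
move=> y0 yx x1 B /nbhs_ballP[e /= e0 eB].
pose s := Num.min (1 / 2) (e / 2).
have s0 : 0 < s by rewrite lt_min !divr_gt0.
have [s2 se] : s <= 1 / 2 /\ s <= e / 2 by split; rewrite ge_min lexx ?orbT.
have x0 : 0 <= x by exact: le_trans yx.
(* The point is moved by the fraction [s] towards the interior point [(2/3, 1/3)]; each coordinate
   changes by at most [s], hence by less than [e]. *)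
exists ((1 - s) * x + s * 2 / 3, (1 - s) * y + s / 3); split.
- rewrite /triD/=.
  have h1 : (1 - s) * x <= 1 - s by rewrite -[leRHS]mulr1 ler_wpM2l//; lra.
  have h2 : (1 - s) * y <= (1 - s) * x by rewrite ler_wpM2l//; lra.
  have h3 : 0 <= (1 - s) * y by rewrite mulr_ge0//; lra.
  by repeat split; lra.
- have xs : 0 <= s * x <= s.
    by rewrite mulr_ge0 ?(ltW s0)//= -[leRHS]mulr1 ler_wpM2l// ltW.
  have ys : 0 <= s * y <= s.
    rewrite mulr_ge0 ?(ltW s0)//= -[leRHS]mulr1.
    by rewrite ler_wpM2l ?(le_trans yx)// ltW.
  move/andP: xs => [? ?]; move/andP: ys => [? ?].
  by apply: eB; split; rewrite /ball/= ltr_norml; apply/andP; split; lra.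
Qed.

Lemma tri_retract_closure z : closure (@triD R) (tri_retract z).
Proof.
have /andP[x0 x1] := @clamp_itv 1 z.1 ler01.
have /andP[y0 yx] := @clamp_itv _ z.2 x0.
exact: closure_triD.
Qed.

End retraction.

Lemma continuous_within_comp (T U W : topologicalType) (A : set U)
    (r : T -> U) (F : U -> W) :
  {within A, continuous F} -> continuous r -> (forall t, A (r t)) ->
  continuous (F \o r).
Proof.
move=> /subspace_continuousP cF cr Ar t B /= /(cF _ (Ar t)) FB.
have /cr : nbhs (r t) [set u | A u -> B (F u)] by [].
rewrite /= !nbhs_simpl => h.
by apply: (@filterS _ (nbhs t) _ _ _ _ h) => u /=; apply.
Qed.

(** * Continuous extension from the open triangle to its closure *)

Section continuous_extension.
Variables (R : realType) (V : normedModType R) (F : R -> R -> V).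
Hypothesis eF : extendable F.

Lemma ext_cvg x y : closure (@triD R) (x, y) ->
  (fun w : R * R => F w.1 w.2) @ within (@triD R) (nbhs (x, y)) --> ext F x y.
Proof. exact: eF. Qed.

(** The bound on [F] near [(x, y)] also holds near every point [(x', y')] close to it, by passing to
    the interior of the neighbourhood. Letting the argument tend to [(x', y')] inside the triangle
    transfers the bound to [ext F]. *)
Lemma ext_continuous :
  {within closure (@triD R), continuous (fun w : R * R => ext F w.1 w.2)}.
Proof.
apply/subspace_continuousP => -[x y] xy; apply/cvgrPdist_le => e e0.
have /cvgrPdist_le/(_ e e0) := ext_cvg xy.
rewrite !near_withinE => /nbhs_interior; apply: filterS => -[x' y'] H cxy'.
have FP := within_nbhs_proper cxy'.
have h := cvg_norm (cvgB (cvg_cst (ext F x y)) (ext_cvg cxy')).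
apply: (cvgr_to_le (h _ _ _)).
by rewrite near_withinE; exact: H.
Qed.

(** The filter within the triangle keeps the point itself, so the limit estimate can be evaluated
    there. *)
Lemma ext_id x y : triD (x, y) -> ext F x y = F x y.
Proof.
move=> Dxy; apply/eqP; rewrite -subr_eq0 -normr_le0; apply/ler_addgt0Pr => e e0.
rewrite add0r.
have /cvgrPdist_le/(_ e e0) := ext_cvg (subset_closure Dxy).
by rewrite near_withinE => /nbhs_singleton; exact.
Qed.

End continuous_extension.

(** * Partial derivatives inside the triangle, and limits of matrices *)

Lemma derivable_mx_is_derive (R : realType) m n (F : R -> 'M[R]_(m.+1, n.+1))
    x : derivable F x 1 -> mx_is_derive F x (derive1 F x).
Proof.
move=> dF i j; rewrite derive1E derive_mx// mxE.
by apply: derivableP; move/derivable_mxP : dF; exact.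
Qed.

Lemma near_triD (R : realType) (x y : R) : triD (x, y) ->
  \forall z \near (x, y), triD z.
Proof.
rewrite /triD/= => -[x0 [x1 [y0 yx]]].
(* Half of [x - y], because both coordinates move towards each other. *)
pose d := Num.min (Num.min x (1 - x)) (Num.min y ((x - y) / 2)).
have d0 : 0 < d by rewrite !lt_min x0 subr_gt0 x1 y0 divr_gt0 ?subr_gt0.
exists (ball x d, ball y d); first by split; exact: nbhsx_ballx.
move=> [x' y'] [/= ]; rewrite /ball/= !lt_min !ltr_norml.
move=> /andP[/andP[/andP[? ?] /andP[? ?]] /andP[/andP[? ?] /andP[? ?]]].
move=> /andP[/andP[/andP[? ?] /andP[? ?]] /andP[/andP[? ?] /andP[? ?]]].
by repeat split; lra.
Qed.

(** The triangle is open, so derivatives at its points do not see the values of [G] outside it. *)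
Lemma has_partials_is_derive (R : realType) m n
    (F G : R -> R -> 'M[R]_(m.+1, n.+1)) (x y : R) :
  has_partials F -> (forall x y : R, triD (x, y) -> G x y = F x y) ->
  triD (x, y) ->
  mx_is_derive (G^~ y) x (pdx F x y) /\ mx_is_derive (G x) y (pdy F x y).
Proof.
move=> pF GF Dxy; have [dx dy] := pF _ _ Dxy; have nD := near_triD Dxy.
split.
- apply: near_eq_mx_is_derive (derivable_mx_is_derive dx).
  have c : continuous (fun x' : R => (x', y)).
    by move=> x'; exact: (cvg_pair cvg_id (cvg_cst y)).
  have := c x _ nD; rewrite /= !nbhs_simpl => h.
  by apply: (@filterS _ (nbhs x) _ _ _ _ h) => x' /= Dx'; rewrite GF.
- apply: near_eq_mx_is_derive (derivable_mx_is_derive dy).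
  have c : continuous (fun y' : R => (x, y')).
    by move=> y'; exact: (cvg_pair (cvg_cst x) cvg_id).
  have := c y _ nD; rewrite /= !nbhs_simpl => h.
  by apply: (@filterS _ (nbhs y) _ _ _ _ h) => y' /= Dy'; rewrite GF.
Qed.

Lemma cvg_mxP (R : realType) (T : Type) (Fl : set_system T) m n
    (F : T -> 'M[R]_(m.+1, n.+1)) (L : 'M[R]_(m.+1, n.+1)) : Filter Fl ->
  F @ Fl --> L <-> (forall i j, (fun t => F t i j) @ Fl --> L i j).
Proof.
move=> FF; split=> [FL i j|FL].
  apply: (cvg_comp F (fun A : 'M[R]_(m.+1, n.+1) => A i j)) FL _.
  exact: coord_continuous.
apply/cvgrPdist_le => e e0.
have : \forall t \near Fl, forall ij : 'I_m.+1 * 'I_n.+1,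
    `|L ij.1 ij.2 - F t ij.1 ij.2| <= e.
  by apply: filter_forall => ij; have /cvgrPdist_le/(_ e e0) := FL ij.1 ij.2.
apply: filterS => t Ht; rewrite [leLHS]/Num.Def.normr/= mx_normrE.
by rewrite (bigmax_le _ (ltW e0))// => ij _; rewrite !mxE.
Qed.

(** * One-sided calculus on the closed unit interval *)

Section one_sided_calculus.
Variable R : realType.

(** Properness makes the limit defining [der01] unique. The nearby point is taken to the right in
    the left half of the interval and to the left otherwise. *)
Lemma within01_proper (x : R) : x \in `[0, 1] ->
  ProperFilter (within `[0, 1] x^').
Proof.
rewrite in_itv/= => /andP[x0 x1].
apply: Build_ProperFilter_ex => B
  /nbhs_ballP[e /= e0 eB].
pose s := Num.min (1 / 2) (e / 2).
have s0 : 0 < s by rewrite lt_min !divr_gt0.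
have [s2 se] : s <= 1 / 2 /\ s <= e / 2 by split; rewrite ge_min lexx ?orbT.
have [xlt|xge] := ltP x (1 / 2).
  exists (x + s); apply: eB.
  - by rewrite /ball/= ltr_norml; apply/andP; split; lra.
  - by apply/eqP; lra.
  - by rewrite /= in_itv/=; apply/andP; split; lra.
exists (x - s); apply: eB.
- by rewrite /ball/= ltr_norml; apply/andP; split; lra.
- by apply/eqP; lra.
- by rewrite /= in_itv/=; apply/andP; split; lra.
Qed.

Lemma derivable01_continuous (V : normedModType R) (f : R -> V) :
  derivable01 f -> {within `[0, 1], continuous f}.
Proof.
move=> df; apply/subspace_continuousP => x x01.
have qx := df x x01; have FP := within01_proper x01.
have tx : (fun t : R => t - x) @ within `[0, 1] x^' --> (0 : R).
  rewrite -(subrr x); apply: cvgB; last exact: cvg_cst.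
  apply: cvg_within_filter; apply: cvg_within_filter; exact: cvg_id.
have : (fun t => (t - x) *: quot01 f x t) @ within `[0, 1] x^' --> (0 : V).
  by rewrite -(scale0r (der01 f x)); exact: cvgZ.
move=> /cvgrPdist_le h.
apply/cvgrPdist_le => e e0.
have := h _ e0; rewrite !near_withinE; apply: filterS => t Ht t01.
have [->|tx'] := eqVneq t x; first by rewrite subrr normr0 ltW.
have := Ht tx' t01; rewrite sub0r normrN /quot01/= scalerA.
by rewrite mulfV ?subr_eq0// scale1r distrC.
Qed.

Lemma derivable01_is_derive m n (f : R -> 'M[R]_(m.+1, n.+1)) (x : R) :
  derivable01 f -> 0 < x -> x < 1 -> mx_is_derive f x (der01 f x).
Proof.
move=> df x0 x1 i j.
have x01 : x \in `[0, 1] by rewrite in_itv/= !ltW.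
have /cvg_mxP/(_ i j)/cvgrPdist_le h := df x x01.
apply: is_derive_eps => e e0.
have := h _ e0; rewrite !near_withinE => /nbhs_ballP[d /= d0 Hd].
exists (Num.min d (Num.min x (1 - x))).
  by rewrite !lt_min d0 x0 subr_gt0 x1.
move=> t tx; rewrite !lt_min => /andP[td /andP[]].
rewrite !ltr_norml => /andP[? ?] /andP[? ?].
have /(_ _ tx) := Hd t; rewrite /ball/= distrC => /(_ td).
have t01 : t \in `[0, 1] by rewrite in_itv/=; apply/andP; split; lra.
move=> /(_ t01); rewrite /quot01 !mxE => H.
have nt : t - x != 0 by rewrite subr_eq0.
rewrite (_ : _ - _ = - ((der01 f x i j - (t - x)^-1 * (f t i j - f x i j)) *
  (t - x))); last by field.
by rewrite normrN normrM ler_wpM2r.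
Qed.

(** The mean value theorem writes the quotient as [g u] with [u] between [x] and [t], and [g] is
    continuous at [x]. Only interior derivatives enter, so the endpoints are covered too. *)
Lemma quot01_scalar_cvg (f g : R -> R) (x : R) :
  {within `[0, 1], continuous f} -> {within `[0, 1], continuous g} ->
  (forall t : R, 0 < t -> t < 1 -> is_derive t 1 f (g t)) -> x \in `[0, 1] ->
  (t - x)^-1 * (f t - f x) @[t --> within `[0, 1] x^'] --> g x.
Proof.
move=> cf /subspace_continuousP cg df x01; have {}cg := cg x x01.
have step s t : 0 <= s -> s < t -> t <= 1 ->
    exists2 u, u \in `]s, t[ & f t - f s = g u * (t - s).
  move=> s0 st t1; apply: MVT => //.
    move=> u; rewrite in_itv/= => /andP[su ut].
    by apply: df; [exact: le_lt_trans su|exact: lt_le_trans t1].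
  apply: continuous_subspaceW cf => u; rewrite /= !in_itv/= => /andP[su ut].
  by rewrite (le_trans s0)//= (le_trans ut).
apply/cvgrPdist_le => e e0.
have /cvgrPdist_le/(_ e e0) := cg.
rewrite !near_withinE => /nbhs_ballP[d /= d0 Hd].
apply/nbhs_ballP; exists d => // t xt tx t01.
move: x01 t01 xt; rewrite /ball/= !in_itv/= => /andP[x0 x1] /andP[t0 t1].
rewrite ltr_norml => /andP[xt1 xt2].
have [u ub ->] : exists2 u, x <= u <= t \/ t <= u <= x &
    (t - x)^-1 * (f t - f x) = g u.
  have [tltx|xltt|tE] := ltgtP t x; last by move/eqP: tE; rewrite (negbTE tx).
  - have [u] := step _ _ t0 tltx x1; rewrite in_itv/= => /andP[tu ux] fE.
    exists u; first by right; rewrite !ltW.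
    have -> : f t - f x = g u * (t - x) by rewrite -opprB fE; ring.
    by field; rewrite subr_eq0.
  - have [u] := step _ _ x0 xltt t1; rewrite in_itv/= => /andP[xu ut] fE.
    exists u; first by left; rewrite !ltW.
    by rewrite fE; field; rewrite subr_eq0.
have [u0 u1 ud] : [/\ 0 <= u, u <= 1 & `|x - u| < d].
  case: ub => /andP[? ?]; split; rewrite ?ltr_norml;
    by first [lra | apply/andP; split; lra].
by apply: Hd => //; rewrite in_itv/= u0.
Qed.

Lemma quot01_mx_cvg m n (f g : R -> 'M[R]_(m.+1, n.+1)) (x : R) :
  (forall i j, {within `[0, 1], continuous (fun t => f t i j)}) ->
  (forall i j, {within `[0, 1], continuous (fun t => g t i j)}) ->
  (forall t : R, 0 < t -> t < 1 -> mx_is_derive f t (g t)) -> x \in `[0, 1] ->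
  quot01 f x @ within `[0, 1] x^' --> g x.
Proof.
move=> cf cg df x01; apply/cvg_mxP => i j.
have -> : (fun t => quot01 f x t i j) =
    (fun t => (t - x)^-1 * (f t i j - f x i j)).
  by apply/funext => t; rewrite /quot01 !mxE.
apply: (@quot01_scalar_cvg (fun t => f t i j) (fun t => g t i j)) => // t t0 t1.
exact: df.
Qed.

(** The quotients of [f] never leave [[0, 1]], so [f] may be replaced by any [h] that agrees with it
    there. This allows a second application with [f] itself a one-sided derivative. *)
Lemma derivable01_of_interior m n (f h g : R -> 'M[R]_(m.+1, n.+1)) :
  (forall x, x \in `[0, 1] -> f x = h x) ->
  (forall i j, {within `[0, 1], continuous (fun t => h t i j)}) ->
  (forall i j, {within `[0, 1], continuous (fun t => g t i j)}) ->
  (forall t : R, 0 < t -> t < 1 -> mx_is_derive h t (g t)) ->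
  derivable01 f /\ forall x, x \in `[0, 1] -> der01 f x = g x.
Proof.
move=> fh ch cg dh.
have H x : x \in `[0, 1] -> quot01 f x @ within `[0, 1] x^' --> g x.
  move=> x01; apply: cvg_trans (quot01_mx_cvg ch cg dh x01).
  apply: near_eq_cvg; rewrite near_withinE; near=> t => t01.
  by rewrite /quot01 !fh.
split=> [x /H Hx|x x01]; first by apply/cvg_ex; exists (g x).
have FP := within01_proper x01.
by apply: cvg_lim (H _ x01); exact: norm_hausdorff.
Unshelve. all: by end_near. Qed.

End one_sided_calculus.

(** * Kernel and data extended continuously to the whole plane and line *)

Definition tri_extension (R : realType) (V : Type) (F : R -> R -> V) (x y : R)
  : V := F (tri_retract (x, y)).1 (tri_retract (x, y)).2.

Lemma tri_extension_id (R : realType) (V : Type) (F : R -> R -> V) (x y : R) :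
  0 <= y -> y <= x -> x <= 1 -> tri_extension F x y = F x y.
Proof. by move=> y0 yx x1; rewrite /tri_extension tri_retract_id. Qed.

Lemma tri_extension_continuous (R : realType) m n
    (F : R -> R -> 'M[R]_(m.+1, n.+1)) :
  {within closure (@triD R), continuous (fun w : R * R => F w.1 w.2)} ->
  mx_continuous (fun z : R * R => tri_extension F z.1 z.2).
Proof.
move=> cF i j z.
apply: (@continuous_comp _ _ _ (fun z : R * R => tri_extension F z.1 z.2)
  (fun A : 'M[R]_(m.+1, n.+1) => A i j)); last exact: coord_continuous.
exact: (continuous_within_comp cF (@continuous_tri_retract R)
  (@tri_retract_closure R)).
Qed.

Lemma clamp_continuous01 (R : realType) m n (f : R -> 'M[R]_(m.+1, n.+1)) :
  derivable01 f -> mx_continuous (f \o clamp 1).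
Proof.
move=> /derivable01_continuous cf i j x.
apply: (@continuous_comp _ _ _ (f \o clamp 1)
  (fun A : 'M[R]_(m.+1, n.+1) => A i j)); last exact: coord_continuous.
apply: (continuous_within_comp cf (@continuous_clamp1 R)) => t.
by rewrite /= in_itv/= clamp_itv.
Qed.

Lemma clamp_is_derive01 (R : realType) m n (f : R -> 'M[R]_(m.+1, n.+1)) x :
  derivable01 f -> 0 < x -> x < 1 ->
  mx_is_derive (f \o clamp 1) x (der01 f x).
Proof.
move=> df x0 x1; apply: near_eq_mx_is_derive (derivable01_is_derive df x0 x1).
near=> t; rewrite /= clamp_id//; apply/andP; split; apply: ltW.
  by near: t; exact: lt_nbhsr.
by near: t; exact: lt_nbhsl.
Unshelve. all: by end_near. Qed.

Lemma ext_extension_id (R : realType) (V : normedModType R) (F : R -> R -> V)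
    (x y : R) :
  extendable F -> triD (x, y) -> tri_extension (ext F) x y = F x y.
Proof.
move=> eF Dxy; have [x0 [x1 [y0 yx]]] := Dxy.
by rewrite tri_extension_id ?(ltW y0) ?(ltW yx) ?(ltW x1)//; exact: ext_id.
Qed.

(** The witnesses are [K] and the extensions of its derivatives to the closed triangle, all composed
    with [tri_retract]: continuous everywhere, linked by differentiation inside the triangle,
    unchanged on its closure. *)
Lemma C2_triD_extension (R : realType) m n (K : R -> R -> 'M[R]_(m.+1, n.+1)) :
  C2_triD K -> exists Kc Kx Ky Kxx Kyy : R -> R -> 'M[R]_(m.+1, n.+1),
  [/\ mx_continuous (fun z : R * R => Kc z.1 z.2),
    mx_continuous (fun z : R * R => Kx z.1 z.2) /\
    mx_continuous (fun z : R * R => Ky z.1 z.2),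
    mx_continuous (fun z : R * R => Kxx z.1 z.2) /\
    mx_continuous (fun z : R * R => Kyy z.1 z.2),
    forall x y : R, 0 < y -> y < x -> x < 1 ->
      [/\ mx_is_derive (Kc^~ y) x (Kx x y), mx_is_derive (Kc x) y (Ky x y),
        mx_is_derive (Kx^~ y) x (Kxx x y) & mx_is_derive (Ky x) y (Kyy x y)] &
    forall x y : R, 0 <= y -> y <= x -> x <= 1 ->
      [/\ Kc x y = K x y, Ky x y = ext (pdy K) x y,
        Kxx x y = ext (pdx (pdx K)) x y & Kyy x y = ext (pdy (pdy K)) x y]].
Proof.
move=> [cK [pK [pKx pKy]] [eKx eKy] [eKxx _] [_ eKyy]].
exists (tri_extension K), (tri_extension (ext (pdx K))),
  (tri_extension (ext (pdy K))), (tri_extension (ext (pdx (pdx K)))),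
  (tri_extension (ext (pdy (pdy K)))); split.
- exact: tri_extension_continuous.
- by split; apply: tri_extension_continuous; exact: ext_continuous.
- by split; apply: tri_extension_continuous; exact: ext_continuous.
- move=> x y y0 yx x1.
  have Dxy : triD (x, y) by rewrite /triD/= (lt_trans y0).
  have [|dx dy] := has_partials_is_derive (G := tri_extension K) pK _ Dxy.
    by move=> u v [_ [? [? ?]]]; rewrite tri_extension_id// ltW.
  have [|dxx _] := has_partials_is_derive
    (G := tri_extension (ext (pdx K))) pKx _ Dxy.
    by move=> u v; exact: (ext_extension_id eKx).
  have [|_ dyy] := has_partials_is_derive
    (G := tri_extension (ext (pdy K))) pKy _ Dxy.
    by move=> u v; exact: (ext_extension_id eKy).
  split.
  + by move: dx; rewrite -(ext_extension_id eKx Dxy).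
  + by move: dy; rewrite -(ext_extension_id eKy Dxy).
  + by move: dxx; rewrite -(ext_extension_id eKxx Dxy).
  + by move: dyy; rewrite -(ext_extension_id eKyy Dxy).
- by move=> x y y0 yx x1; split; exact: tri_extension_id.
Qed.

(** * Return from the extended data to the original problem *)

Theorem lemma3p2 (R : realType) (P Q : R -> 'M[R]_2) (K : R -> R -> 'M[R]_2)
    (hP : C1_01 P) (hQ : C1_01 Q) (hK : kernel_solution P Q K)
    (lambda : R) (b : 'cV[R]_2) (hb : norm2 b = 1)
    (psi : R -> 'cV[R]_2) (hpsi : ivp_solution P lambda b psi)
    (Phi : R -> 'cV[R]_2)
    (hPhi : forall x : R, x \in `[0, 1] ->
      Phi x = psi x + mxint 0 x (fun y => K x y *m psi y)) :
  ivp_solution Q lambda b Phi.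
Proof.
have [C2K pde Kdiag Ky0] := hK.
have [Kc [Kxc [Kyc [Kxxc [Kyyc [cKc [cKxc cKyc] [cKxxc cKyyc] dKs KsE]]]]]] :=
  C2_triD_extension C2K.
have [[dpsi dpsi1] psi_eq psi_0 psi1_0] := hpsi.
have [dP _] := hP; have [dQ _] := hQ.
have c01 x : (0 : R) <= x -> x <= 1 -> clamp 1 x = x.
  by move=> x0 x1; rewrite clamp_id// x0.
have in01 x : (0 : R) <= x -> x <= 1 -> x \in `[0, 1].
  by move=> x0 x1; rewrite in_itv/= x0.
set Pc := P \o clamp 1; set Qc := Q \o clamp 1.
set psic := psi \o clamp 1; set psi1c := der01 psi \o clamp 1.
have cPc : mx_continuous Pc by exact: clamp_continuous01.
have cQc : mx_continuous Qc by exact: clamp_continuous01.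
have cpsic : mx_continuous psic by exact: clamp_continuous01.
have cpsi1c : mx_continuous psi1c by exact: clamp_continuous01.
have dKc x y : 0 < y -> y < x -> x < 1 ->
    mx_is_derive (Kc^~ y) x (Kxc x y) /\ mx_is_derive (Kc x) y (Kyc x y).
  by move=> y0 yx x1; have [] := dKs x y y0 yx x1.
have dKxc x y : 0 < y -> y < x -> x < 1 -> mx_is_derive (Kxc^~ y) x (Kxxc x y).
  by move=> y0 yx x1; have [] := dKs x y y0 yx x1.
have dKyc x y : 0 < y -> y < x -> x < 1 -> mx_is_derive (Kyc x) y (Kyyc x y).
  by move=> y0 yx x1; have [] := dKs x y y0 yx x1.
have pdec x y : 0 <= y -> y <= x -> x <= 1 ->
    Kxxc x y - Kyyc x y + Kc x y *m Pc y = Qc x *m Kc x y.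
  move=> y0 yx x1; have [-> _ -> ->] := KsE x y y0 yx x1.
  rewrite /Pc /Qc/= !c01 ?(le_trans y0)// ?(le_trans yx)//.
  by apply: pde; exact: closure_triD.
have Kdiagc x : 0 <= x -> x <= 1 ->
    Kc x x = 2^-1 *: mxint 0 x (fun s => Qc s - Pc s).
  move=> x0 x1; have [-> _ _ _] := KsE x x x0 (lexx x) x1.
  rewrite (Kdiag x (in01 x x0 x1)); congr (_ *: _).
  apply: eq_mxint => s; rewrite in_itv/= => /andP[s0 sx].
  by rewrite /Qc /Pc/= c01// (le_trans sx).
have Ky0c x : 0 <= x -> x <= 1 -> Kyc x 0 = 0.
  move=> x0 x1; have [_ -> _ _] := KsE x 0 (lexx 0) x0 x1.
  by rewrite Ky0// in01.
have dpsic x : 0 < x -> x < 1 -> mx_is_derive psic x (psi1c x).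
  move=> x0 x1; rewrite /psi1c/= c01 ?ltW//.
  exact: clamp_is_derive01.
have dpsi1c x : 0 < x -> x < 1 ->
    mx_is_derive psi1c x (Pc x *m psic x - lambda *: psic x).
  move=> x0 x1; rewrite /Pc /psic/= c01 ?ltW//.
  (* The equation for [psi] turns the right-hand side back into its second one-sided derivative. *)
  rewrite -psi_eq ?in01 ?ltW// opprD opprK addrCA subrr addr0.
  exact: clamp_is_derive01.
have psi1c0 : psi1c 0 = 0 by rewrite /psi1c/= c01.
have PhiE x : x \in `[0, 1] -> Phi x = transmuted Kc psic x.
  move=> x01; rewrite (hPhi x x01) /transmuted.
  move: x01; rewrite in_itv/= => /andP[x0 x1].
  rewrite /psic/= (c01 x x0 x1); congr (_ + _).
  apply: eq_mxint => y; rewrite in_itv/= => /andP[y0 yx].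
  by have [-> _ _ _] := KsE x y y0 yx x1; rewrite (c01 y y0 (le_trans yx x1)).
have ctr := transmuted_continuous cKc cpsic.
have ctr1 := transmuted1_continuous cKc cKxc cpsic cpsi1c.
have [dPhi der_Phi] := derivable01_of_interior PhiE ctr ctr1
  (transmuted_is_derive cKc cKxc cpsic dKc dpsic).
have ctr2 := transmuted2_continuous (lambda := lambda) cQc cKc cpsic.
(* The second differentiation starts from [der01 Phi], which [der_Phi] identifies with [transmuted1]
   on [[0, 1]]. *)
have [dPhi1 der_Phi1] := derivable01_of_interior der_Phi ctr1 ctr2
  (transmuted1_is_derive cPc cQc cKc cKxc cKyc cKxxc cKyyc cpsic cpsi1c
    dKc dKxc dKyc pdec Kdiagc Ky0c dpsic dpsi1c psi1c0).
split=> // [x x01||].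
- rewrite der_Phi1// -PhiE// opprB.
  move: x01; rewrite in_itv/= => /andP[x0 x1].
  by rewrite /Qc/= c01// subrK.
- by rewrite hPhi ?in01// mxint_point addr0.
(* At 0 the diagonal condition gives a zero kernel, as its integral is over a single point. *)
- rewrite der_Phi ?in01// /transmuted1 psi1c0 Kdiagc// !mxint_point.
  by rewrite scaler0 mul0mx !addr0.
Qed.
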